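(* Let $d \ge 1$, $\sigma>0$, $\beta>0$, and $\mathbf{p}\in\mathbb{Z}^d$. Let $H:\mathbb{R}^d\to\mathbb{Z}^d$ be the quantization map $H(\mathbf{x}) = \lfloor \mathbf{x} + \mathbf{0.5}\rfloor$, where the floor is applied coordinatewise and $\mathbf{0.5}=(0.5,\dots,0.5)$. Let $\mathbf{x}\sim\mathcal{N}(\mathbf{p},\sigma^2\mathbf{I}_d)$ (a natural query) and, independently, $\boldsymbol{\delta}\sim\mathcal{N}(0,\beta^2\mathbf{I}_d)$ (a perturbation), so that $\mathbf{x}+\boldsymbol{\delta}$ is an attack query. Define the false positive rate $\alpha^{fp} = \mathbb{P}[H(\mathbf{x})\neq \mathbf{p}]$ and the detection rate $\alpha^{det} = \mathbb{P}[H(\mathbf{x}+\boldsymbol{\delta}) = H(\mathbf{x})]$. Then $$\alpha^{det} \le 1 - \bigl(2 - 2\Phi(0.5\,\beta^{-1})\bigr)^d\,(1-\alpha^{fp}),$$ where $\Phi$ is the cumulative distribution function of the standard normal distribution $\mathcal{N}(0,1)$.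
   Context: Toy model of a stateful defense: a query is flagged as an attack query if and only if its feature vector $H(\cdot)$ is exactly equal to that of a prior query; here the prior query is the natural query $\mathbf{x}$, and a natural query is counted as correctly (non-falsely) handled when $H(\mathbf{x})=\mathbf{p}$, so $1-\alpha^{fp}=\mathbb{P}[H(\mathbf{x})=\mathbf{p}]$. *)

(* Defs.v *)
From HB Require Import structures.
From mathcomp Require Import all_boot all_order all_algebra.
From mathcomp Require Import all_classical all_reals all_analysis.
Set Implicit Arguments. Unset Strict Implicit. Unset Printing Implicit Defensive.
Import Order.TTheory GRing.Theory Num.Theory.
Local Open Scope classical_set_scope.
Local Open Scope ring_scope.

(* Mutual independence of a finite family of real random variables:
   the product rule for every choice of measurable sets (choosing B i = setT
   gives every subfamily). *)
Definition mutually_independent (R : realType) (dm : measure_display)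
  (T : measurableType dm) (P : probability T R) (I : finType)
  (Y : I -> T -> R) : Prop :=
  forall B : I -> set R, (forall i, measurable (B i)) ->
    P (\bigcap_(i in [set: I]) (Y i @^-1` B i)) =
    (\prod_(i : I) P (Y i @^-1` B i))%E.

Definition joint (T R : Type) (d : nat) (X D : 'I_d -> T -> R)
  : 'I_d + 'I_d -> T -> R :=
  fun k => match k with inl i => X i | inr i => D i end.

(* A real random variable Y has law N(m, s^2) (s = standard deviation). *)
Definition has_normal_law (R : realType) (dm : measure_display)
  (T : measurableType dm) (P : probability T R) (Y : T -> R) (m s : R) : Prop :=
  forall B : set R, measurable B -> P (Y @^-1` B) = normal_prob m s B.

Definition quant (R : realType) (d : nat) (x : 'I_d -> R) : 'I_d -> int :=
  fun i => Num.floor (x i + 2^-1).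

Definition Phi (R : realType) (t : R) : R :=
  fine (normal_prob (0:R) 1 `]-oo, t]).

(* Main.v *)
Require Import Defs.
From HB Require Import structures.
From mathcomp Require Import all_boot all_order all_algebra.
From mathcomp Require Import all_classical all_reals all_analysis.
From mathcomp Require Import measurable_realfun ring lra.
Import Order.TTheory GRing.Theory Num.Theory numFieldNormedType.Exports.
Local Open Scope classical_set_scope.
Local Open Scope ring_scope.

(** Only one coordinate is needed. Write [q = 2 - 2 Phi (1 / (2 beta))]. For a
    fixed query [x], the perturbed coordinate stays in the cell of [p] iff the
    centred Gaussian perturbation falls in some window of width 1, which is
    most likely when the window is centred at 0; hence it leaves the cell with
    probability at least [q]. By independence and Fubini, the event
    "[H x = p] and coordinate 0 of [x + delta] leaves the cell", which is
    disjoint from detection, has probability at least [q P(H x = p)], and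
    [q ^ d <= q] since [0 <= q <= 1]. *)

(** * Translation, reflection and scaling of Gaussian laws *)

(** Lebesgue measure is determined by its values on the intervals []a, b]], whose length a
    translation preserves. *)
Lemma lebesgue_measureD (R : realType) (c : R) (A : set R) : measurable A ->
  pushforward lebesgue_measure
    ((fun x => x + c) : _ -> measurableTypeR R) A = lebesgue_measure A.
Proof.
move=> mA.
have mD : measurable_fun setT ((fun x => x + c) :
    measurableTypeR R -> measurableTypeR R) by exact: measurable_funD.
pose m := measure_function_pushforward__canonical__measure_function_Measure
  lebesgue_measure mD.
apply/esym/(@lebesgue_measure_unique R m) => //= _ [[a b]] _ <-.
rewrite /m/= /pushforward.
have -> : (fun x => x + c) @^-1` `]a, b] = `]a - c, b - c]%classic.
  by apply/seteqP; split => x /=; rewrite !in_itv/= ltrBlDr lerBrDr.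
rewrite !lebesgue_measure_itv/= !lte_fin ltrD2r.
by case: ifP => // _; rewrite -!EFinB opprB addrA subrK.
Qed.

Lemma normal_pdf_le (R : realType) (m m' s x : R) : s != 0 ->
  `|x - m'| <= `|x - m| -> normal_pdf m s x <= normal_pdf m' s x.
Proof.
move=> s0 xm; rewrite !normal_pdfE// ler_pM2l ?normal_peak_gt0//.
rewrite ler_expR !mulNr lerN2 ler_wpM2r//.
  by rewrite invr_ge0 mulrn_wge0// sqr_ge0.
by rewrite -[leLHS]real_normK ?num_real// -[leRHS]real_normK ?num_real//
  ler_pXn2r ?nnegrE.
Qed.

Lemma normal_prob_shift (R : realType) (m s c : R) (A : set R) : s != 0 ->
  measurable A ->
  normal_prob m s ((fun x => x + c) @^-1` A) = normal_prob (m + c) s A.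
Proof.
move=> s0 mA; rewrite /normal_prob.
transitivity (\int[pushforward lebesgue_measure
    ((fun x => x + c)%R : _ -> measurableTypeR R)]_(x in A)
    (normal_pdf (m + c)%R s x)%:E)%E.
  rewrite ge0_integral_pushforward//.
  - apply: eq_integral => x _ /=; congr EFin.
    by rewrite !normal_pdfE// /normal_fun opprD addrACA subrr addr0.
  - exact: measurable_funD.
  - by apply/measurable_EFinP/measurable_funTS; exact: measurable_normal_pdf.
  - by move=> x _; rewrite lee_fin normal_pdf_ge0.
apply: eq_measure_integral => [|mD B mB _]; first exact: measurable_funD.
exact: lebesgue_measureD.
Qed.

Lemma normal_prob0N (R : realType) (s : R) (A : set R) : s != 0 ->
  measurable A -> normal_prob 0 s (-%R @^-1` A) = normal_prob 0 s A.
Proof.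
move=> s0 mA; rewrite /normal_prob.
transitivity (\int[pushforward lebesgue_measure
    (-%R : _ -> measurableTypeR R)]_(x in A) (normal_pdf 0 s x)%:E)%E.
  rewrite ge0_integral_pushforward//.
  - apply: eq_integral => x _ /=; congr EFin.
    by rewrite !normal_pdfE// /normal_fun !subr0 sqrrN.
  - by apply/measurable_EFinP/measurable_funTS; exact: measurable_normal_pdf.
  - by move=> x _; rewrite lee_fin normal_pdf_ge0.
by apply: eq_measure_integral => B mB _; exact: lebesgue_measureN.
Qed.

(** Substitution along [x / s]; this links a Gaussian of deviation [s] to [Phi], which is defined
    with deviation 1. *)
Lemma normal_prob_standardize (R : realType) (s t : R) : 0 < s ->
  normal_prob 0 s `]-oo, t] = normal_prob 0 1 `]-oo, t / s].
Proof.
move=> s0; rewrite /normal_prob.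
have s_neq0 : s != 0 by rewrite gt_eqF.
pose F (x : R) := s^-1 * x.
have dF x : derivable F x 1 by exact: derivableM.
have F'E : F^`()%classic = cst s^-1.
  apply/funext => x; rewrite derive1E /F deriveM// derive_cst scaler0 addr0.
  by rewrite derive_id scaler1.
have cF : continuous F by move=> x; apply/differentiable_continuous/derivable1_diffP.
have -> : t / s = F t by rewrite /F mulrC.
rewrite (@increasing_ge0_integration_by_substitutionNy _ F).
- apply: eq_integral => x _; congr EFin; rewrite F'E/= !normal_pdfE ?oner_neq0//.
  rewrite fctE /normal_fun /normal_peak /F /= !subr0 expr1n mul1r.
  rewrite [RHS]mulrAC; congr (_ * expR _).
    rewrite -mulrnAr sqrtrM ?sqr_ge0// sqrtr_sqr ger0_norm ?ltW//.
    by rewrite invfM mulrC.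
  by field.
- by move=> x y _ _ xy; rewrite /F ltr_pM2l// invr_gt0.
- by move=> x _; rewrite F'E; exact: cvg_cst.
- by rewrite F'E; exact: is_cvg_cst.
- by rewrite F'E; exact: cvg_cst.
- split; first by move=> x _; exact: dF.
  by apply: cvg_at_left_filter; exact: cF.
- apply/gt0_cvgMrNy; rewrite ?invr_gt0//.
- by apply: continuous_subspaceT; apply: continuous_normal_pdf; rewrite oner_neq0.
- by move=> x _; exact: normal_pdf_ge0.
Qed.

(** * Windows of fixed width under a centred Gaussian *)

Lemma normal_prob_itv_split (R : realType) (m s a b c : R) : a <= b -> b <= c ->
  normal_prob m s `[a, c[ = (normal_prob m s `[a, b[ + normal_prob m s `[b, c[)%E.
Proof.
move=> ab bc; rewrite -measureU//.
  by rewrite -(@itv_bndbnd_setU _ _ (BLeft a) (BLeft b) (BLeft c)).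
rewrite -subset0 => x [/=]; rewrite !in_itv/= => /andP[_ xb] /andP[bx _].
by rewrite ltNge bx in xb.
Qed.

(** Translating the window by [c] amounts to moving the mean to [- c], after which both sides
    integrate over [[a, b[] and the densities compare pointwise. *)
Lemma normal_prob_itv_shift_le (R : realType) (s a b c : R) : s != 0 ->
  {in `[a, b[, forall x, `|x + c| <= `|x|} ->
  (normal_prob 0 s `[a, b[ <= normal_prob 0 s `[(a + c)%R, (b + c)%R[)%E.
Proof.
move=> s0 H.
rewrite [leRHS](_ : _ = normal_prob (- c) s `[a, b[); last first.
  rewrite -[in RHS](add0r (- c)) -normal_prob_shift//; congr normal_prob.
  by apply/seteqP; split => x /=; rewrite !in_itv/= lerBrDr ltrBlDr.
apply: ge0_le_integral => //=.
- by move=> x _; rewrite lee_fin normal_pdf_ge0.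
- by apply/measurable_EFinP/measurable_funTS; exact: measurable_normal_pdf.
- by apply/measurable_EFinP/measurable_funTS; exact: measurable_normal_pdf.
- move=> x xab; rewrite lee_fin normal_pdf_le// subr0 opprK.
  exact: H.
Qed.

(* Sliding the window by u gains a piece on one side and loses a piece on the
   other; translating the gained piece by the window width maps it closer to
   the mean, onto the lost one. *)
Lemma normal_prob_window_le (R : realType) (s h u : R) : s != 0 -> 0 <= h ->
  (normal_prob 0 s `[(- h - u)%R, (h - u)%R[ <= normal_prob 0 s `[(- h)%R, h[)%E.
Proof.
move=> s0 h0.
have fn (A : set R) : measurable A -> normal_prob 0 s A \is a fin_num.
  by move=> mA; exact: fin_num_measure.
have [u0|u0] := leP 0 u.
(* Adding [[h - u, h[] to both sides and cutting the union at [- h] leaves [[- h - u, - h[] against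
   its translate by [2 * h]. This is valid even when the two windows are disjoint. *)
- rewrite -(@leeD2rE _ (normal_prob 0 s `[(h - u)%R, h[)) ?fn//.
  rewrite -normal_prob_itv_split; [|lra..].
  rewrite (@normal_prob_itv_split _ _ _ _ (- h)); [|lra..].
  rewrite addeC leeD2l//.
  have := @normal_prob_itv_shift_le _ s (- h - u) (- h) (2 * h) s0.
  rewrite (_ : - h - u + 2 * h = h - u)%R; last by ring.
  rewrite (_ : - h + 2 * h = h)%R; last by ring.
  apply=> x; rewrite in_itv/= => /andP[_ xh].
  rewrite [leRHS]ler0_norm; last by lra.
  by rewrite ler_norml; apply/andP; split; lra.
- rewrite -(@leeD2lE _ (normal_prob 0 s `[(- h)%R, (- h - u)%R[)) ?fn//.
  rewrite -normal_prob_itv_split; [|lra..].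
  rewrite (@normal_prob_itv_split _ _ _ _ h); [|lra..].
  rewrite addeC leeD2r//.
  have := @normal_prob_itv_shift_le _ s h (h - u) (- (2 * h)) s0.
  rewrite (_ : h - u + - (2 * h) = - h - u)%R; last by ring.
  rewrite (_ : h + - (2 * h) = - h)%R; last by ring.
  apply=> x; rewrite in_itv/= => /andP[xh _].
  rewrite [leRHS]ger0_norm; last by lra.
  by rewrite ler_norml; apply/andP; split; lra.
Qed.

(** For the centred window, symmetry gives both tails the mass [1 - Phi (h / s)]. *)
Lemma normal_prob_window_Phi (R : realType) (s h u : R) : 0 < s -> 0 <= h ->
  (normal_prob 0 s `[(- h - u)%R, (h - u)%R[ <= (2 * Phi (h / s) - 1)%:E)%E.
Proof.
move=> s0 h0; have s_neq0 : s != 0 by rewrite gt_eqF.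
apply: le_trans (@normal_prob_window_le _ s h u s_neq0 h0) _.
have fn (A : set R) : measurable A -> normal_prob 0 s A \is a fin_num.
  by move=> mA; exact: fin_num_measure.
have PhiE : (Phi (h / s))%:E = normal_prob 0 s `]-oo, h].
  by rewrite normal_prob_standardize// /Phi fineK// fin_num_measure.
have tailR : normal_prob 0 s `]h, +oo[ = (1 - Phi (h / s))%:E.
  by rewrite EFinB PhiE -setCitvl probability_setC.
have tailL : normal_prob 0 s `]-oo, (- h)%R[ = (1 - Phi (h / s))%:E.
  rewrite -tailR -normal_prob0N//; congr normal_prob.
  by apply/seteqP; split => x /=; rewrite !in_itv/= ?andbT ltrN2.
(* Inclusion in []-oo, h]] suffices, so the mass of the endpoint [h] need not be computed. *)
have : (normal_prob 0 s `]-oo, (- h)%R[ + normal_prob 0 s `[(- h)%R, h[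
    <= (Phi (h / s))%:E)%E.
  rewrite -measureU//; last first.
    rewrite -subset0 => x [/=]; rewrite !in_itv/= => xh /andP[hx _].
    by rewrite ltNge hx in xh.
  rewrite PhiE; apply: le_measure; rewrite ?inE//.
    by apply: measurableU.
  by move=> x /=; rewrite !in_itv/= => -[/ltW/le_trans->//|/andP[_ /ltW]//]; lra.
rewrite tailL -(fineK (fn `[(- h)%R, h[%classic _))// -EFinD !lee_fin.
lra.
Qed.

(* The law of [(X, D)] restricted to [K] is a product measure, which Fubini
   integrates section by section. *)
Lemma indep_section_lower_bound (R : realType)
    (d0 d1 d2 : measure_display) (T : measurableType d0)
    (T1 : measurableType d1) (T2 : measurableType d2)
    (P : probability T R) (nu : probability T2 R)
    (X : T -> T1) (D : T -> T2) (K : set T) (L : set (T1 * T2)) (q : \bar R) :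
  measurable_fun setT X -> measurable_fun setT D ->
  measurable K -> measurable L ->
  (forall A B, measurable A -> measurable B ->
    P (K `&` (X @^-1` A `&` D @^-1` B)) = P (K `&` X @^-1` A) * nu B)%E ->
  (0 <= q)%E -> (forall x, q <= nu (xsection L x))%E ->
  (q * P K <= P (K `&` [set t | L (X t, D t)]))%E.
Proof.
move=> mX mD mK mL ind q0 qL.
have mXD : measurable_fun setT (fun t => (X t, D t)).
  exact: measurable_fun_pair.
have mpre d (S : measurableType d) (f : T -> S) (A : set S) :
    measurable_fun setT f -> measurable A -> measurable (f @^-1` A).
  by move=> mf mA; rewrite -[_ @^-1` _]setTI; exact: mf.
pose m0 := measure_function_pushforward__canonical__measure_function_Measure
  (mrestr P mK) mX.
have m0E A : m0 A = P (K `&` X @^-1` A) by rewrite setIC.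
have m0fin : fin_num_fun m0.
  move=> A mA; rewrite m0E fin_num_measure//.
  by apply: measurableI => //; exact: mpre.
pose m1 : {finite_measure set T1 -> \bar R} :=
  HB.pack (Measure.sort m0) m0 (Measure_isFinite.Build _ _ _ m0 m0fin).
pose m := measure_function_pushforward__canonical__measure_function_Measure
  (mrestr P mK) mXD.
have mE A : m A = P (K `&` (fun t => (X t, D t)) @^-1` A) by rewrite setIC.
have <- : m L = P (K `&` [set t | L (X t, D t)]) by rewrite mE.
(* The hypothesis on rectangles identifies [m] with the product of [m1] and [nu]. *)
rewrite -(@product_measure_unique _ _ _ _ _ m1 nu m)//; last first.
  move=> A B mA mB; rewrite mE ind//; congr (_ * _)%E.
  exact/esym/m0E.
(* As [P K] is the total mass of [m1], the left side is the integral of the constant [q]. *)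
have -> : P K = m1 setT by rewrite [RHS]m0E preimage_setT setIT.
rewrite -integral_cst//; apply: ge0_le_integral => //.
  exact: measurable_fun_xsection.
by move=> x _; exact: qL.
Qed.

(** * Quantization cells *)

Lemma floor_half_eq (R : realType) (k : int) :
  [set x : R | Num.floor (x + 2^-1) = k] = `[k%:~R - 2^-1, k%:~R + 2^-1[%classic.
Proof.
apply/seteqP; split => x /=; rewrite in_itv/=.
  move=> /eqP; rewrite floor_eq intrD => /andP[h1 h2].
  by apply/andP; split; lra.
move=> /andP[h1 h2]; apply/eqP; rewrite floor_eq intrD.
by apply/andP; split; lra.
Qed.

Lemma measurable_floor_half_eq (R : realType) (k : int) :
  measurable [set x : R | Num.floor (x + 2^-1) = k].
Proof. by rewrite floor_half_eq. Qed.

Lemma measurable_eq_floor_half (R : realType) (d0 : measure_display)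
    (T : measurableType d0) (f g : T -> R) :
  measurable_fun setT f -> measurable_fun setT g ->
  measurable [set t | Num.floor (f t + 2^-1) = Num.floor (g t + 2^-1)].
Proof.
move=> mf mg.
pose E k := [set x : R | Num.floor (x + 2^-1) = k].
(* Split according to the common integer value: countably many cases. *)
rewrite [X in measurable X](_ : _ = \bigcup_k (f @^-1` E k `&` g @^-1` E k)).
  apply: countable_bigcupT_measurable => [|k]; first exact: countableP.
  rewrite -[f @^-1` _]setTI -[g @^-1` _]setTI.
  by apply: measurableI; [apply: mf|apply: mg] => //; exact: measurable_floor_half_eq.
apply/seteqP; split => [t /= fg|t [k _ [/= -> ->]]//].
by exists (Num.floor (g t + 2^-1)).
Qed.

(** In the variable [y], the cell of [k] is a window of half-width 1/2 centred at [k - x], of mass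
    at most [2 * Phi (2^-1 / s) - 1]. *)
Lemma normal_prob_floor_half_neq (R : realType) (s x : R) (k : int) : 0 < s ->
  ((2 - 2 * Phi (2^-1 / s))%:E <=
   normal_prob 0 s [set y | Num.floor (x + y + 2^-1) <> k])%E.
Proof.
move=> s0.
have -> : [set y | Num.floor (x + y + 2^-1) <> k] =
    ~` `[(- 2^-1 - (x - k%:~R))%R, (2^-1 - (x - k%:~R))%R[%classic.
  apply/seteqP; split => y /=; apply: contra_not; have := floor_half_eq R k;
    move=> /seteqP[h1 h2]; rewrite in_itv/=.
    move=> /andP[y1 y2]; apply: h2; rewrite /= in_itv/=.
    by apply/andP; split; lra.
  move=> /h1; rewrite /= in_itv/= => /andP[y1 y2].
  by apply/andP; split; lra.
rewrite probability_setC// leeBrDr ?fin_num_measure//.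
have h0 : 0 <= (2^-1 : R) by [].
apply: (le_trans (leeD2l _ (@normal_prob_window_Phi R s 2^-1 (x - k%:~R) s0 h0))).
by rewrite -EFinD lee_fin; lra.
Qed.

(** * Independence and the final bound *)

Lemma mutually_independent_joint_restr (R : realType) (dm : measure_display)
    (T : measurableType dm) (P : probability T R) (d : nat)
    (X D : 'I_d -> T -> R) (C : 'I_d -> set R) (i0 : 'I_d) (A B : set R) :
  mutually_independent P (joint X D) ->
  (forall i, measurable (C i)) -> measurable A -> measurable B ->
  let K := \bigcap_i (X i @^-1` C i) in
  (P (K `&` (X i0 @^-1` A `&` D i0 @^-1` B)) =
   P (K `&` X i0 @^-1` A) * P (D i0 @^-1` B))%E.
Proof.
move=> ind mC mA mB K.
(* Constrains coordinate [i0] only, so that the event becomes an intersection over the whole joint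
   family. *)
pose at0 (E : set R) i := if i == i0 then E else setT.
have mat0 E i : measurable E -> measurable (at0 E i).
  by rewrite /at0; case: ifP.
have key E : measurable E ->
    (P (K `&` (X i0 @^-1` A `&` D i0 @^-1` E)) =
     \prod_i P (X i @^-1` (C i `&` at0 A i)) * P (D i0 @^-1` E))%E.
  move=> mE; pose F k := match k with
    inl i => C i `&` at0 A i | inr i => at0 E i end.
  have mF k : measurable (F k).
    by case: k => i /=; [apply: measurableI => //|]; exact: mat0.
  have -> : K `&` (X i0 @^-1` A `&` D i0 @^-1` E) =
      \bigcap_(k in setT) (joint X D k @^-1` F k).
    apply/seteqP; split => [t [Kt [At Et]] [i|i] _ /=|t Ft].
    - by split; [exact: Kt|rewrite /at0; case: eqP => // ->].
    - by rewrite /at0; case: eqP => // ->.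
    - split; first by move=> i _; have [] := Ft (inl i) Logic.I.
      have /= [_] := Ft (inl i0) Logic.I; rewrite /at0 eqxx => At.
      by have /= := Ft (inr i0) Logic.I; rewrite /at0 eqxx.
  rewrite (ind F mF) big_sumType/=; congr (_ * _)%E.
  rewrite (bigD1 i0)//= {1}/at0 eqxx big1 ?mule1// => i /negPf ii0.
  by rewrite /at0 ii0 preimage_setT probability_setT.
(* With [setT] for [E], the product in [key] is recognized as the probability of [K] intersected
   with the preimage of [A]. *)
have := key setT measurableT.
rewrite preimage_setT setIT probability_setT mule1 => ->.
exact: key.
Qed.

Theorem theorem1 (R : realType) (dm : measure_display) (T : measurableType dm)
  (P : probability T R) (d : nat) (sigma beta : R) (p : 'I_d -> int)
  (X Dl : 'I_d -> {RV P >-> R}) :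
  (0 < d)%N -> 0 < sigma -> 0 < beta ->
  mutually_independent P (joint (fun i => (X i : T -> R)) (fun i => (Dl i : T -> R))) ->
  (forall i, has_normal_law P (X i) (p i)%:~R sigma) ->
  (forall i, has_normal_law P (Dl i) 0 beta) ->
  let alpha_fp := P [set t | quant (fun i => X i t) <> p] in
  let alpha_det := P [set t | quant (fun i => X i t + Dl i t) = quant (fun i => X i t)] in
  (alpha_det <= 1 - ((2 - 2 * Phi (2^-1 / beta)) ^+ d)%:E * (1 - alpha_fp))%E.
Proof.
move=> d0 _ beta0 ind _ lawD /=.
set alpha_fp := P [set t | _ <> _].
set q := 2 - 2 * Phi (2^-1 / beta).
pose i0 := Ordinal d0.
pose C i := [set x : R | Num.floor (x + 2^-1) = p i].
have mC i : measurable (C i) by exact: measurable_floor_half_eq.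
have mX i : measurable_fun setT (X i) by exact: measurable_funPT.
have mD i : measurable_fun setT (Dl i) by exact: measurable_funPT.
pose K := \bigcap_(i in setT) ((X i : T -> R) @^-1` C i).
have KE : K = [set t | quant (fun i => X i t) = p].
  apply/seteqP; split => t /=; first by move=> Kt; apply/funext => i; exact: Kt.
  by move=> Xp i _; exact: (congr1 (fun f => f i) Xp).
have mK : measurable K.
  apply: fin_bigcap_measurable => [|i _]; first exact: finite_finset.
  by rewrite -[_ @^-1` _]setTI; exact: mX.
have -> : (1 - alpha_fp = P K)%E.
  rewrite /alpha_fp (_ : [set t | _ <> _] = ~` K); last by rewrite KE.
  by rewrite -probability_setC ?setCK//; exact: measurableC.
pose L := [set z : R * R | Num.floor (z.1 + z.2 + 2^-1) <> p i0].
have mL : measurable L.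
  rewrite (_ : L = ~` ((fun z : R * R => z.1 + z.2) @^-1` C i0))//.
  apply: measurableC; rewrite -[_ @^-1` _]setTI.
  exact: measurable_funD.
have qL x : (q%:E <= normal_prob 0 beta (xsection L x))%E.
  rewrite [xsection L x](_ : _ = [set y | Num.floor (x + y + 2^-1) <> p i0]).
    exact: normal_prob_floor_half_neq.
  by apply/seteqP; split => y; rewrite /xsection/= inE.
(* [q] bounds from below the probability of any section, for instance the one at 0. *)
have q1 : q <= 1.
  by rewrite -lee_fin (le_trans (qL 0))// probability_le1//; exact: measurable_xsection.
have q0 : 0 <= q.
  rewrite /q subr_ge0 ger_pMr// -lee_fin /Phi fineK ?fin_num_measure//.
  exact: probability_le1.
pose E := K `&` [set t | L (X i0 t, Dl i0 t)].
have mE : measurable E.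
  apply: measurableI => //.
  rewrite -[X in measurable X]setTI.
  exact: (measurable_fun_pair (mX i0) (mD i0)).
have leE : (q%:E * P K <= P E)%E.
  apply: (@indep_section_lower_bound R _ _ _ _ _ _ P (normal_prob 0 beta)
    _ _ _ _ _ (mX i0) (mD i0)) => //.
  move=> A B mA mB; rewrite -[X in (_ * X)%E](lawD i0)//.
  exact: (@mutually_independent_joint_restr R _ _ P d X Dl C).
(* Detection excludes [E]: if the query and its perturbation share a cell and that cell is [p],
   coordinate [i0] has not left [p i0]. *)
apply: (@le_trans _ _ (1 - P E)%E).
  rewrite -probability_setC//; apply: le_measure; rewrite ?inE.
  - rewrite [X in measurable X](_ : _ = \bigcap_(i in setT)
      [set t | Num.floor (X i t + Dl i t + 2^-1) = Num.floor (X i t + 2^-1)]).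
      apply: fin_bigcap_measurable => [|i _]; first exact: finite_finset.
      apply: measurable_eq_floor_half => //; exact: measurable_funD.
    apply/seteqP; split => t /= h; last by apply/funext => i; exact: h.
    by move=> i _; exact: (congr1 (fun f => f i) h).
  - exact: measurableC.
  - move=> t /= h [Kt]; apply.
    by have := congr1 (fun f => f i0) h; rewrite /quant /= => ->; exact: Kt.
apply: leeB => //; apply: le_trans leE.
apply: lee_wpmul2r => //; rewrite lee_fin.
(* Powers of [q] decrease with the exponent, and [1 <= d]. *)
by rewrite -[leRHS]expr1 ler_wiXn2l.
Qed.
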